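(* Let $\pi :A\to B$ be a surjective map between nonempty countable sets. Let $\mu$ and $\rho$ be two probability measures on $[0,\infty]^A$. Assume that $\mu$ is a $\pi$-lift. Further, assume it is possible to fix a section $\mathfrak s$ of $\pi$ such that the following two conditions simultaneously hold: (A) Let $Z$ be a $\rho$-distributed random variable. For every $b\in B$, let $W_b$ denote the random variable $(Z_c : c\in A,\ \pi(c)\neq b)$. For every $b\in B$, every $a\in\pi^{-1}(\{b\})$ and every event $H\in \sigma(W_b)$ of positive probability, the conditional distribution of $Z_{\mathfrak s(b)}$ given $H$ is stochastically dominated by the conditional distribution of $Z_a$ given $H$. (B) Let $Y$ be a $\mu$-distributed random variable. For every $b\in B$, let $X_b:=\max_{a\in \pi^{-1}(\{b\})}Y_a$ (almost surely well defined since $\mu$ is a $\pi$-lift). For every $a\in A$, let $Y'_a:=X_{\pi(a)}\,\mathbf{1}_{\mathfrak s(\pi(a))=a}$. Then the distribution of $Y'=(Y'_a)_{a\in A}$ is stochastically dominated by $\rho$. Then $\mu$ is stochastically dominated by $\rho$.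
   Context: $[0,\infty]$ carries its usual order and topology; $[0,\infty]^A$ carries the product order ($x\le y$ iff $x_a\le y_a$ for all $a$) and product topology. A probability measure $\mu$ on $[0,\infty]^A$ is a $\pi$-lift if for $\mu$-almost every $x$, for every $b\in B$, at most one $a\in\pi^{-1}(\{b\})$ satisfies $x_a\neq0$. A section of $\pi$ is a map $s:B\to A$ with $\pi\circ s=\mathrm{id}_B$. Stochastic domination of $\mu$ by $\nu$ (on an ordered measurable space) means there exist $X\sim\mu$, $Y\sim\nu$ on a common probability space with $X\le Y$ almost surely. ''Countable'' means finite or countably infinite. *)

(* Defs.v *)
From HB Require Import structures.
From mathcomp Require Import all_boot all_order all_algebra.
From mathcomp Require Import all_classical all_reals all_analysis measurable_realfun.
Set Implicit Arguments. Unset Strict Implicit. Unset Printing Implicit Defensive.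
Import Order.TTheory GRing.Theory Num.Theory.
Local Open Scope classical_set_scope.
Local Open Scope ring_scope.

Definition coord_sets (R : realType) (A : Type) (P : A -> Prop)
  : set (set (A -> \bar R)) :=
  [set S | exists c U, P c /\ measurable (U : set (\bar R)) /\ S = (fun z : A -> \bar R => z c) @^-1` U].

Arguments coord_sets : clear implicits.

Definition prodE (R : realType) (A : Type) :=
  g_sigma_algebraType (coord_sets R A (fun _ : A => True)).

Definition stoch_dom (R : realType) (d : measure_display) (S : measurableType d)
  (le : S -> S -> Prop) (mu nu : set S -> \bar R) : Prop :=
  exists (dO : measure_display) (Om : measurableType dO) (P : probability Om R)
         (X Y : Om -> S),
    [/\ measurable_fun setT X, measurable_fun setT Y,
        (forall U, measurable U -> P (X @^-1` U) = mu U),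
        (forall U, measurable U -> P (Y @^-1` U) = nu U) &
        {ae P, forall w, le (X w) (Y w)}].

Definition prod_le (R : realType) (A : Type) (x y : prodE R A) : Prop :=
  forall a, (x a <= y a)%E.

Definition is_lift (R : realType) (A B : Type) (pi : A -> B)
  (mu : set (prodE R A) -> \bar R) : Prop :=
  {ae mu, forall x : prodE R A, forall b a1 a2, pi a1 = b -> pi a2 = b ->
      x a1 <> 0%E -> x a2 <> 0%E -> a1 = a2}.

Definition cond_coord (R : realType) (A : Type) (rho : set (prodE R A) -> \bar R)
  (H : set (prodE R A)) (a : A) : set (\bar R) -> \bar R :=
  fun U => ((fine (rho (H `&` ((fun z : prodE R A => z a) @^-1` U)))
            / fine (rho H))%:E).

(* the map Y |-> Y' of condition (B); X_b is the max of Y over the fibre,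
   written as a supremum (it is an a.s. max under the pi-lift property) *)
Definition lift_collapse (R : realType) (A : eqType) (B : Type) (pi : A -> B)
  (s : B -> A) (y : prodE R A) : prodE R A :=
  fun a => if s (pi a) == a
           then ereal_sup [set y c | c in pi @^-1` [set pi a]]
           else 0%E.

(* Main.v *)
Require Import Defs.
From HB Require Import structures.
From mathcomp Require Import all_boot all_order all_algebra.
Import Order.TTheory GRing.Theory Num.Theory.
Local Open Scope ring_scope.

(* By a Strassen-type argument it is enough to compare [mu] and [rho] on the
   sets described by finitely many conditions [q_i <= x_(a_i)] with [q_i > 0],
   combined in an increasing way.  Given such a set [E], let [E*] be the set of
   those [x] such that, for some section [t], moving the value at [s b] to [t b]
   for every [b], with [0] on the rest of the fibre, yields a point of [E].  As
   thresholds are positive, the collapse of a lift in [E] lies in [E*], so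
   (B) gives [mu E <= rho E*].  Moving one fibre at a time, (A) gives
   [rho E* <= rho E]: on each atom of the finitely many conditions on the
   coordinates off the fibre of [b], the condition on the fibre is either trivial,
   or impossible, or a single lower bound on [x_(s b)]; in the last case the bound
   is one that suffices at some fixed [c] in the fibre, and [x_c] dominates
   [x_(s b)] given that atom.

   For the Strassen part, encode [x] by the bits [q_k <= x_(a_k)], where
   [(a_k, q_k)] enumerates all coordinates and positive rationals.  Hall's
   theorem with real weights couples the first [n] bits monotonically; an
   ultrafilter limit of these couplings is a finitely additive probability on
   pairs of bit sequences, and nested intervals realize its values on cylinders
   by Lebesgue measure on [[0, 1[]. *)

Set Implicit Arguments. Unset Strict Implicit. Unset Printing Implicit Defensive.

(** * Hall's theorem with real weights *)

Section Hall.
Variables (R : realFieldType) (S T : finType) (r : S -> T -> bool).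
Implicit Types (p : S -> R) (q : T -> R) (C : {set S}).

Definition nbhd C : {set T} := [set y | [exists x in C, r x y]].

Definition hall_cond p q :=
  forall C, \sum_(x in C) p x <= \sum_(y in nbhd C) q y.

Lemma nbhdU C1 C2 : nbhd (C1 :|: C2) = nbhd C1 :|: nbhd C2.
Proof.
apply/setP => y; rewrite !inE; apply/existsP/orP.
- by case=> x /andP[/setUP[] xC xy]; [left|right]; apply/existsP; exists x; rewrite xC.
- by case=> /existsP[x /andP[xC xy]]; exists x; rewrite inE xC ?orbT.
Qed.

Lemma nbhdS C1 C2 : C1 \subset C2 -> nbhd C1 \subset nbhd C2.
Proof. by move=> /setUidPr <-; rewrite nbhdU subsetUl. Qed.

(** The induction in [hall_coupling] runs on the total size of the supports of [p] and [q]. *)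
Let supp (I : finType) (f : I -> R) := #|[set i | f i != 0]|.

Lemma supp_lt (I : finType) (f g : I -> R) i :
  (forall j, f j != 0 -> g j != 0) -> f i = 0 -> g i != 0 -> (supp f < supp g)%N.
Proof.
move=> fg fi gi; apply: proper_card; apply/properP; split.
  by apply/subsetP => j; rewrite !inE; apply: fg.
by exists i; rewrite !inE // fi eqxx.
Qed.

Lemma supp_le (I : finType) (f g : I -> R) :
  (forall j, f j != 0 -> g j != 0) -> (supp f <= supp g)%N.
Proof.
by move=> fg; apply: subset_leq_card; apply/subsetP => j; rewrite !inE; apply: fg.
Qed.

Lemma sum_restr (I : finType) (f : I -> R) (P Q : pred I) :
  \sum_(i | P i) (if Q i then f i else 0) = \sum_(i | P i && Q i) f i.
Proof. by rewrite big_mkcondr. Qed.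

Lemma sum_sub_delta (I : finType) (f : I -> R) (P : pred I) t i0 :
  \sum_(i | P i) (f i - (if i == i0 then t else 0)) =
  \sum_(i | P i) f i - (if P i0 then t else 0).
Proof.
rewrite sumrB; congr (_ - _).
rewrite -big_mkcondr /=; case: ifP => Pi0.
  by rewrite (big_pred1 i0) // => i /=; rewrite andbC; case: eqP => //= ->.
by rewrite big_pred0 // => i; case: eqP => [->|]; rewrite ?andbF // Pi0.
Qed.

(** The second marginal is only bounded by [q], since the totals of [p] and [q] may differ; when
    they agree, equality follows. *)
Lemma hall_coupling p q :
  (forall x, 0 <= p x) -> (forall y, 0 <= q y) -> hall_cond p q ->
  exists w : S -> T -> R,
    [/\ forall x y, 0 <= w x y,
        forall x y, ~~ r x y -> w x y = 0,
        forall x, \sum_y w x y = p x &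
        forall y, \sum_x w x y <= q y].
Proof.
have [k] := ubnP (supp p + supp q).
elim: k p q => // k IH p q; rewrite ltnS => le_k p0 q0 hpq.
have [/existsP[x /existsP[y /and3P[rxy px qy]]]|noedge] :=
  boolP [exists x, exists y, [&& r x y, p x != 0 & q y != 0]]; last first.
  (* With no edge between the supports, Hall's condition on singletons forces [p] to vanish. *)
  exists (fun _ _ => 0); split=> // [x|y]; last by rewrite big1_eq.
  rewrite big1_eq; apply/esym/eqP; rewrite eq_le p0 andbT.
  rewrite leNgt; apply/negP => px.
  have := hpq [set x]; rewrite big_set1 big1 => [/(lt_le_trans px)|y].
    by rewrite ltxx.
  rewrite inE => /existsP[x' /andP[/set1P -> rxy]].
  apply/eqP/negPn/negP => qy; case/negP: noedge.
  by apply/existsP; exists x; apply/existsP; exists y; rewrite rxy qy gt_eqF.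
(* Push as much mass [t] as possible along the edge [x -> y].  Either a support
   shrinks, or some [C0] becomes tight and the problem splits into the one between
   [C0] and [nbhd C0] and the one between their complements. *)
pose slack C := \sum_(y in nbhd C) q y - \sum_(x in C) p x.
(* These are the sets whose Hall inequality loses slack: only its right side drops by [t]. If [x] is
   in [C], both sides drop. *)
pose adm C := (x \notin C) && (y \in nbhd C).
pose t0 := Num.min (p x) (q y).
have [C0 [t [t_ge0 tpx tqy tslack tight]]] : exists C0 t, [/\ 0 <= t, t <= p x, t <= q y,
    forall C, adm C -> t <= slack C &
    [\/ t = p x, t = q y | adm C0 /\ slack C0 = t]].
  have slack0 C : 0 <= slack C by rewrite subr_ge0 hpq.
  have t0ge0 : 0 <= t0 by rewrite le_min p0 q0.
  have t0p : t0 <= p x by rewrite ge_min lexx.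
  have t0q : t0 <= q y by rewrite ge_min lexx orbT.
  have t0eq : t0 = p x \/ t0 = q y by rewrite /t0; case: leP; auto.
  have [/existsP[C1 aC1]|noC] := boolP [exists C, adm C]; last first.
    exists set0, t0; split=> //; last by case: t0eq; [constructor 1|constructor 2].
    by move=> C aC; case/negP: noC; apply/existsP; exists C.
  case: (@arg_minP _ _ _ C1 adm slack aC1) => C0 aC0 minC.
  have [le|lt] := leP t0 (slack C0).
    exists C0, t0; split=> //; last by case: t0eq; [constructor 1|constructor 2].
    by move=> C aC; apply: le_trans le (minC _ aC).
  exists C0, (slack C0); split=> //; first exact: le_trans (ltW lt) t0p.
  - exact: le_trans (ltW lt) t0q.
  - by constructor 3.
pose p' x' := p x' - (if x' == x then t else 0).
pose q' y' := q y' - (if y' == y then t else 0).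
have p'0 x' : 0 <= p' x' by rewrite /p'; case: eqP => [->|]; rewrite ?subr0 // subr_ge0.
have q'0 y' : 0 <= q' y' by rewrite /q'; case: eqP => [->|]; rewrite ?subr0 // subr_ge0.
have h' : hall_cond p' q'.
  move=> C; rewrite /p' /q' !sum_sub_delta.
  have [xC|xC] := boolP (x \in C).
    have -> : y \in nbhd C by rewrite inE; apply/existsP; exists x; rewrite xC.
    by rewrite lerD2r hpq.
  have [yC|yC] := boolP (y \in nbhd C); last by rewrite !subr0 hpq.
  by rewrite subr0 lerBrDr addrC -lerBrDr tslack // /adm xC.
have p'n x' : p' x' != 0 -> p x' != 0.
  apply: contra_neq => e; apply/eqP; rewrite eq_le p'0 andbT /p' e sub0r.
  by case: ifP => _; rewrite ?oppr0 // oppr_le0.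
have q'n y' : q' y' != 0 -> q y' != 0.
  apply: contra_neq => e; apply/eqP; rewrite eq_le q'0 andbT /q' e sub0r.
  by case: ifP => _; rewrite ?oppr0 // oppr_le0.
have p'x : p' x = p x - t by rewrite /p' eqxx.
have q'y : q' y = q y - t by rewrite /q' eqxx.
suff [w [w0 wr wp wq]] : exists w : S -> T -> R,
    [/\ forall x y, 0 <= w x y, forall x y, ~~ r x y -> w x y = 0,
        forall x, \sum_y w x y = p' x & forall y, \sum_x w x y <= q' y].
  exists (fun x' y' => w x' y' + (if (x' == x) && (y' == y) then t else 0)).
  split=> [x' y'|x' y' nr|x'|y'].
  - by rewrite addr_ge0 //; case: ifP.
  - rewrite wr // add0r; case: ifP => // /andP[/eqP e1 /eqP e2].
    by rewrite e1 e2 rxy in nr.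
  - rewrite big_split /= wp /p'; case: eqP => [->|_] /=; last by rewrite big1_eq addr0 subr0.
    by rewrite -big_mkcond big_pred1_eq subrK.
  - rewrite big_split /= -lerBrDr; apply: le_trans (wq _) _.
    rewrite lerD2l lerN2; case: (y' == y) => /=; last first.
      by rewrite big1 // => i _; rewrite andbF.
    under eq_bigr do rewrite andbT.
    by rewrite -big_mkcond big_pred1_eq.
have [tp|p'xn] := eqVneq t (p x).
  apply: IH => //; apply: leq_trans le_k.
  rewrite -addSn leq_add //; last exact: supp_le.
  by apply: (@supp_lt _ _ _ x) => //; rewrite p'x tp subrr.
have [tq|q'yn] := eqVneq t (q y).
  apply: IH => //; apply: leq_trans le_k.
  rewrite -addnS leq_add //; first exact: supp_le.
  by apply: (@supp_lt _ _ _ y) => //; rewrite q'y tq subrr.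
case: tight => [tp|tq|[/andP[xC yC] sC]]; [by rewrite tp eqxx in p'xn|by rewrite tq eqxx in q'yn|].
have tightC : \sum_(x in C0) p' x = \sum_(y in nbhd C0) q' y.
  rewrite /p' /q' !sum_sub_delta (negPf xC) yC subr0 -sC /slack.
  by rewrite opprB addrC subrK.
pose p1 x := if x \in C0 then p' x else 0.
pose q1 y := if y \in nbhd C0 then q' y else 0.
pose p2 x := if x \notin C0 then p' x else 0.
pose q2 y := if y \notin nbhd C0 then q' y else 0.
(* Both subproblems are smaller: the support of [p1] misses [x], and that of [q2] misses [y]. *)
have [|||| w1 [w10 w1r w1p w1q]] := IH p1 q1.
- apply: leq_trans le_k; rewrite -addSn leq_add //.
    apply: (@supp_lt _ _ _ x) => //; last by rewrite /p1 (negPf xC).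
    by move=> j; rewrite /p1; case: ifP => [_ /p'n//|]; rewrite eqxx.
  by apply: supp_le => j; rewrite /q1; case: ifP => [_ /q'n//|]; rewrite eqxx.
- by move=> z; rewrite /p1; case: ifP.
- by move=> z; rewrite /q1; case: ifP.
- move=> C; rewrite /p1 /q1 !sum_restr.
  have := h' (C :&: C0).
  under eq_bigl do rewrite inE.
  move=> /le_trans; apply.
  rewrite [leRHS](bigID (mem (nbhd (C :&: C0)))) /=.
  rewrite [leRHS]addrC -[leLHS]add0r lerD ?sumr_ge0 // le_eqVlt; apply/orP; left.
  apply/eqP; apply: eq_bigl => j; case: (boolP (j \in nbhd (C :&: C0))); rewrite ?andbF//.
  move=> jC; have := subsetP (nbhdS (subsetIl C C0)) _ jC.
  by have := subsetP (nbhdS (subsetIr C C0)) _ jC => -> ->.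
have [|||| w2 [w20 w2r w2p w2q]] := IH p2 q2.
- apply: leq_trans le_k; rewrite -addnS leq_add //.
    by apply: supp_le => j; rewrite /p2; case: ifP => [_ /p'n//|]; rewrite eqxx.
  apply: (@supp_lt _ _ _ y) => //; last by rewrite /q2 yC.
  by move=> j; rewrite /q2; case: ifP => [_ /q'n//|]; rewrite eqxx.
- by move=> z; rewrite /p2; case: ifP.
- by move=> z; rewrite /q2; case: ifP.
- move=> C; rewrite /p2 /q2 !sum_restr.
  (* Cancelling the tight equality on [C0] leaves Hall's inequality between the complements. *)
  have := h' (C :|: C0).
  rewrite (bigID (mem C0)) [leRHS](bigID (mem (nbhd C0))) /=.
  rewrite (eq_bigl (mem C0)); last first.
    by move=> i; rewrite !inE andbC; case: (i \in C0); rewrite ?orbT.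
  rewrite [in leRHS](eq_bigl (mem (nbhd C0))); last first.
    by move=> i; rewrite nbhdU in_setU andbC /=; case: (i \in nbhd C0); rewrite ?orbT.
  rewrite tightC lerD2l => h.
  rewrite (eq_bigl (fun i => (i \in C :|: C0) && (i \notin C0))); last first.
    by move=> i; rewrite in_setU; case: (i \in C0); rewrite ?orbF // !andbF.
  apply: (le_trans h); rewrite le_eqVlt; apply/orP; left; apply/eqP.
  by apply: eq_bigl => i; rewrite nbhdU in_setU; case: (i \in nbhd C0); rewrite ?orbF // !andbF.
exists (fun x y => w1 x y + w2 x y); split=> [a b|a b nr|a|b].
- exact: addr_ge0.
- by rewrite w1r // w2r // addr0.
- by rewrite big_split /= w1p w2p /p1 /p2; case: ifP; rewrite ?addr0 ?add0r.
- rewrite big_split /=; apply: le_trans (lerD (w1q b) (w2q b)) _.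
  by rewrite /q1 /q2; case: ifP; rewrite ?addr0 ?add0r.
Qed.
End Hall.

From mathcomp Require Import all_classical all_reals all_analysis measurable_realfun.
From mathcomp Require Import lra.
Import Order.TTheory GRing.Theory Num.Theory.
Import numFieldNormedType.Exports.
Local Open Scope classical_set_scope.
Local Open Scope ring_scope.

(** * Comparison on increasing threshold events *)

Lemma stoch_dom_le (R : realType) d (S : measurableType d) (le : S -> S -> Prop)
    (mu nu : set S -> \bar R) (U : set S) :
  stoch_dom le mu nu -> measurable U -> (forall x y, le x y -> U x -> U y) ->
  (mu U <= nu U)%E.
Proof.
move=> [dO [Om [P [X [Y [mX mY PX PY [N [mN PN0 leN]]]]]]]] mU upU.
rewrite -PX// -PY//.
have mXU : measurable (X @^-1` U) by rewrite -[_ @^-1` _]setTI; exact: mX.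
have mYU : measurable (Y @^-1` U) by rewrite -[_ @^-1` _]setTI; exact: mY.
rewrite (@le_trans _ _ (P (Y @^-1` U `|` N)))//.
  rewrite le_measure ?inE//; first exact: measurableU.
  move=> w XU; have [leXY|nle] := pselect (le (X w) (Y w)); [left|right].
    exact: upU leXY XU.
  exact: leN.
apply: (le_trans (measureU2 _ _ _)) => //.
by rewrite [X in (_ + X)%E](_ : _ = 0%E)// adde0.
Qed.

Lemma bigcup_countable_measurable d (T : measurableType d) (I : countType) (P : set I)
    (F : I -> set T) :
  (forall i, measurable (F i)) -> measurable (\bigcup_(i in P) F i).
Proof.
move=> mF; rewrite bigcup_mkcond; apply: countable_bigcupT_measurable => [|i].
  exact: countableP.
by case: ifP.
Qed.

Lemma measurable_finset d (T : measurableType d) (I : finType) (e : I -> T -> bool)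
    (Q : {set I} -> Prop) :
  (forall i, measurable [set x | e i x]) ->
  measurable [set x | Q (finset (fun i => e i x))].
Proof.
move=> me.
rewrite (_ : [set x | _] = \bigcup_(w in Q) \bigcap_(i in [set: I])
  (if i \in w then [set x | e i x] else ~` [set x | e i x])).
  apply: fin_bigcup_measurable => // w _; apply: fin_bigcap_measurable => // i _.
  by case: ifP => // _; exact: measurableC.
apply/seteqP; split=> x /=.
  move=> Qx; exists (finset (fun i => e i x)) => // i _; rewrite inE.
  by case: ifPn => // /negP.
move=> [w Qw ew]; suff -> : finset (fun i => e i x) = w by [].
apply/setP => i; rewrite inE; have := ew i Logic.I.
by case: ifP => _ /=; [|move/negP/negPf].
Qed.

Lemma measure_fibers (R : realType) d (T : measurableType d)
    (mu : {measure set T -> \bar R}) (I : finType) (f : T -> I) (E : set T) :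
  (forall w, measurable (E `&` f @^-1` [set w])) ->
  mu E = (\sum_(w : I) mu (E `&` f @^-1` [set w]))%E.
Proof.
move=> mE; pose F w := E `&` f @^-1` [set w].
have tF : trivIset [set: I] F by move=> i j _ _ [x [[_ /= <-] [_ /= <-]]].
rewrite {1}(_ : E = \bigcup_(w in [set: I]) F w); last first.
  by apply/seteqP; split=> [x Ex|x [w _ []]//]; exists (f x).
rewrite (@measure_fin_bigcup _ _ _ mu I _ F finite_finset tF) => [|w _]; last exact: mE.
rewrite (@fsbigE _ _ _ _ _ (index_enum I)) ?index_enum_uniq// => [|w _].
  by apply: eq_bigl => w; rewrite in_setT.
by rewrite mem_index_enum.
Qed.

(** With the conditions recorded as a finite set, an increasing threshold event is an up-closed
    predicate [D] of this set. *)
Definition exceed (R : realType) (A : Type) n (a : 'I_n -> A) (q : 'I_n -> R)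
  (x : prodE R A) : {set 'I_n} := finset (fun i => (q i)%:E <= x (a i))%E.

Section coordinates.
Variables (R : realType) (A : Type).

Lemma measurable_coord (a : A) : measurable_fun setT (fun x : prodE R A => x a).
Proof.
move=> _ U mU; rewrite setTI; apply: sub_sigma_algebra; by exists a, U.
Qed.

Lemma measurable_coord_ge (a : A) (r : \bar R) : measurable [set x : prodE R A | (r <= x a)%E].
Proof.
rewrite -[[set _ | _]]setTI; apply: emeasurable_fun_c_infty => //.
exact: measurable_coord.
Qed.

Lemma measurable_exceed n (a : 'I_n -> A) (q : 'I_n -> R) (Q : {set 'I_n} -> Prop) :
  measurable [set x | Q (exceed a q x)].
Proof.
apply: measurable_finset => i; exact: measurable_coord_ge.
Qed.

(** This makes the atoms of the conditions off a fibre admissible as conditioning events in (A). *)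
Lemma exceed_sub_measurable (P : A -> Prop) n (a : 'I_n -> A) (q : 'I_n -> R)
    (K : {set 'I_n}) (Q : {set 'I_n} -> Prop) :
  (forall i, i \in K -> P (a i)) ->
  <<s coord_sets R A P >> [set x | Q (exceed a q x :&: K)%SET].
Proof.
move=> KP.
rewrite (_ : [set x | _] = [set x : g_sigma_algebraType (coord_sets R A P) |
    Q (finset (fun i => (i \in K) && ((q i)%:E <= x (a i))%E))]).
  apply: (@measurable_finset _ (g_sigma_algebraType (coord_sets R A P))) => i.
  have [iK|iK] := boolP (i \in K); last first.
    by rewrite [X in measurable X](_ : _ = set0)//; apply/seteqP; split.
  apply: sub_sigma_algebra; exists (a i), [set t | ((q i)%:E <= t)%E].
  by split; [exact: KP|split=> //; rewrite -set_itvcy; exact: emeasurable_itv].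
apply/funext => x /=; congr Q; apply/setP => i; by rewrite !inE andbC.
Qed.
End coordinates.

(** Coordinates range over all of [\bar R]; this set plays the role of $[0,\infty]^A$. *)
Lemma measurable_nonneg (R : realType) (A : countType) :
  measurable [set x : prodE R A | forall a, (0 <= x a)%E].
Proof.
rewrite (_ : [set _ | _] = \bigcap_(a in [set: A]) [set x : prodE R A | (0 <= x a)%E]).
  rewrite -[X in measurable X]setCK setC_bigcap; apply: measurableC.
  apply: bigcup_countable_measurable => a; apply: measurableC; exact: measurable_coord_ge.
by apply/seteqP; split=> x /= h a; [move=> _|]; exact: h.
Qed.

(** * Use of (A): moving values within the fibres *)

Section switching.
Variables (R : realType) (A B : countType) (pi : A -> B).
Variables (rho : probability (prodE R A) R) (s : B -> A).
Hypothesis s_section : forall b, pi (s b) = b.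
Hypothesis condA : forall (b : B) (a : A), pi a = b ->
     forall H : set (prodE R A),
       <<s coord_sets R A (fun c : A => pi c <> b) >> H ->
       (0 < rho H)%E ->
       stoch_dom (fun x y : \bar R => (x <= y)%E)
         (cond_coord rho H (s b)) (cond_coord rho H a).

Lemma coord_sets_measurable (P : A -> Prop) (H : set (prodE R A)) :
  <<s coord_sets R A P >> H -> measurable H.
Proof.
by apply: sub_sigma_algebra2 => _ [c [U [_ [mU ->]]]]; exists c, U.
Qed.

(** If [rho H] is positive, this is (A) on the increasing set $[r,\infty]$, multiplied by [rho H];
    otherwise the left side is 0. *)
Lemma section_le_coord (b : B) (c : A) (H : set (prodE R A)) (r : \bar R) :
  pi c = b -> <<s coord_sets R A (fun c : A => pi c <> b) >> H ->
  (rho (H `&` [set x | r <= x (s b)]) <= rho (H `&` [set x | r <= x c]))%E.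
Proof.
move=> cb sH; have mH := coord_sets_measurable sH.
have mr a : measurable [set x : prodE R A | (r <= x a)%E].
  exact: measurable_coord_ge.
have [H0|Hpos] := eqVneq (rho H) 0%E.
  suff -> : rho (H `&` [set x | (r <= x (s b))%E]) = 0%E by [].
  apply/eqP; rewrite -measure_le0 -H0 le_measure ?inE//.
  exact: measurableI.
have H_gt0 : (0 < rho H)%E by rewrite lt0e Hpos measure_ge0.
have := @stoch_dom_le _ _ _ _ _ _ [set t | (r <= t)%E] (condA cb sH H_gt0).
have mU : measurable [set t : \bar R | (r <= t)%E].
  by rewrite -set_itvcy; exact: emeasurable_itv.
move=> /(_ mU (fun x y xy rx => le_trans rx xy)).
rewrite /cond_coord lee_fin ler_pM2r ?invr_gt0 ?fine_gt0 ?H_gt0 ?ltey_eq ?fin_num_measure//.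
have fin a : rho (H `&` [set x | (r <= x a)%E]) \is a fin_num.
  by apply: fin_num_measure; exact: measurableI.
by move=> le_fine; rewrite -(fineK (fin (s b))) -(fineK (fin c)) lee_fin.
Qed.

(** Indices and thresholds stay in place, so patterns for [a] and for [recoord b a] can be compared
    as subsets of the same ['I_n]. *)
Definition recoord n (b : B) (a : 'I_n -> A) (i : 'I_n) : A :=
  if pi (a i) == b then s b else a i.

(** Both events are cut along the pattern [w] of the conditions off the fibre of [b], where (A)
    applies. The intersection on the left models moving the value at [s b] to [c]: conditions at
    other points of the fibre count as failed. *)
Lemma switch_fiber (b : B) n (a : 'I_n -> A) (q : 'I_n -> R) (D : {set 'I_n} -> Prop) :
  (forall u v : {set 'I_n}, u \subset v -> D u -> D v) ->
  (rho [set x | exists2 c, pi c = b & D (exceed (recoord b a) q x :&: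
       finset (fun i => (pi (a i) != b) || (a i == c)))%SET] <=
   rho [set x | D (exceed a q x)])%E.
Proof.
move=> upD.
pose off : {set 'I_n} := finset (fun i => pi (a i) != b).
pose f x := (exceed a q x :&: off)%SET.
set E := [set x | exists2 c, _ & _]; set E' := [set x | D _].
have mE : measurable E.
  exact: (@measurable_exceed _ _ n (recoord b a) q (fun v => exists2 c, pi c = b &
    D (v :&: finset (fun i => (pi (a i) != b) || (a i == c)))%SET)).
have mE' : measurable E' by exact: measurable_exceed.
have sf w : <<s coord_sets R A (fun c => pi c <> b) >> (f @^-1` [set w]).
  apply: (@exceed_sub_measurable _ _ _ n a q off (fun v => v = w)) => i.
  by rewrite inE => /eqP.
have mf w : measurable (f @^-1` [set w]) := coord_sets_measurable (sf w).
rewrite (@measure_fibers _ _ _ rho _ f E) 1?(@measure_fibers _ _ _ rho _ f E'); last 2 first.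
- by move=> w; exact: measurableI.
- by move=> w; exact: measurableI.
apply: lee_sum => w _.
(* [K r] says that, on the atom [w], the value [r] placed at some point of the fibre is enough for
   [D]. *)
pose on c (r : \bar R) := finset (fun i => (a i == c) && ((q i)%:E <= r)%E).
pose K r := `[< exists2 c, pi c = b & D (w :|: on c r)%SET >].
have EK x : (E `&` f @^-1` [set w]) x -> K (x (s b)).
  move=> [[c cb Dc] fw]; apply/asboolP; exists c => //; move: Dc; apply: upD.
  apply/fintype.subsetP => i; rewrite -fw !inE /recoord.
  case: (eqVneq (pi (a i)) b) => [e|ne] /= /andP[h]; last by rewrite h.
  by move=> ->; rewrite h orbT.
(* If the conditions off the fibre already suffice, the whole atom lies in [E']. *)
have [Dw|nDw] := pselect (D w).
  rewrite le_measure ?inE; [|exact: measurableI|exact: measurableI|].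
    by [].
  move=> x [_ fw]; split=> //=; apply: upD Dw; rewrite -fw; exact: subsetIl.
(* As [D w] fails, some condition at [c] is met, and lowering [r] to the largest threshold met there
   changes nothing. *)
have KP r : K r -> exists2 i, K (q i)%:E & ((q i)%:E <= r)%E.
  move=> /asboolP[c cb Dc].
  have [i0 oni0|none] := pickP (mem (on c r)); last first.
    case: nDw; move: Dc; congr D; apply/setP => i; rewrite !inE.
    by have := none i; rewrite !inE => ->; rewrite orbF.
  case: (@arg_maxP _ _ _ i0 (mem (on c r)) q oni0) => i oni mx.
  have : i \in on c r by []; rewrite inE => /andP[_ ir]; exists i => //.
  apply/asboolP; exists c => //; apply: upD Dc; apply: finset.setUS.
  apply/fintype.subsetP => j jon; move: (jon); rewrite !inE => /andP[-> _] /=.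
  by rewrite lee_fin; exact: mx.
have [i1 Ki1|noK] := pickP (fun i => K (q i)%:E); last first.
  rewrite (_ : E `&` _ = set0) ?measure0//; apply/seteqP; split=> // x /EK/KP[i].
  by rewrite noK.
(* Let [q i0] be the least sufficient threshold, and [c0] a point where it suffices. On the atom,
   [E] forces [q i0 <= x (s b)], while [q i0 <= x c0] forces [E']. *)
case: (@arg_minP _ _ _ i1 (fun i => K (q i)%:E) q Ki1) => i0 Ki0 mn.
move: (Ki0) => /asboolP[c0 c0b Dc0].
apply: (@le_trans _ _ (rho (f @^-1` [set w] `&` [set x | (q i0)%:E <= x (s b)]))%E).
  have mr : measurable [set x : prodE R A | ((q i0)%:E <= x (s b))%E].
    exact: measurable_coord_ge.
  rewrite le_measure ?inE; [|exact: measurableI|exact: measurableI|].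
    by [].
  move=> x Ex; split; first by case: Ex.
  have [i Ki] := KP _ (EK _ Ex); apply: le_trans; rewrite lee_fin; exact: mn.
apply: (le_trans (section_le_coord _ c0b (sf w))).
have mr : measurable [set x : prodE R A | ((q i0)%:E <= x c0)%E].
  exact: measurable_coord_ge.
rewrite le_measure ?inE; [|exact: measurableI|exact: measurableI|].
  by [].
move=> x [fw /= qx]; split=> //; apply: upD Dc0; apply/fintype.subsetP => i.
rewrite -fw !inE => /orP[/andP[]//|/andP[/eqP -> qi]]; exact: le_trans qi qx.
Qed.

(* Over the fibres of [bs], [v] tells which requirements hold once moved to
   [s b]; the section [t] chooses where to move them back. *)
Definition fits (bs : seq B) n (a : 'I_n -> A) (D : {set 'I_n} -> Prop)
    (v : {set 'I_n}) : Prop :=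
  exists2 t : B -> A, (forall b, pi (t b) = b) &
    D (v :&: finset (fun i => (pi (a i) \in bs) ==> (a i == t (pi (a i)))))%SET.

(** Induction on [bs]: the induction hypothesis handles [bs] with the conditions over [b] read at
    [s b], then [switch_fiber] moves these back. The choice of a point over [b] is absorbed into the
    increasing predicate [D']. *)
Lemma switch_fibers (bs : seq B) n (a : 'I_n -> A) (q : 'I_n -> R)
    (D : {set 'I_n} -> Prop) :
  uniq bs -> (forall u v : {set 'I_n}, u \subset v -> D u -> D v) ->
  (rho [set x | fits bs a D
     (exceed (fun i => if pi (a i) \in bs then s (pi (a i)) else a i) q x)] <=
   rho [set x | D (exceed a q x)])%E.
Proof.
elim: bs a D => [|b bs IH] a D /= => [_|/andP[bbs ubs]] upD.
  rewrite le_measure ?inE; [by []|exact: (@measurable_exceed _ _ n _ q (fits [::] a D))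
    |exact: measurable_exceed|].
  by move=> x [t _]; apply: upD; exact: subsetIl.
apply: le_trans (@switch_fiber b n a q D upD).
pose D' (v : {set 'I_n}) := exists2 c, pi c = b &
  D (v :&: finset (fun i => (pi (a i) != b) || (a i == c)))%SET.
have upD' (u v : {set 'I_n}) : u \subset v -> D' u -> D' v.
  by move=> uv [c cb Dc]; exists c => //; apply: upD Dc; exact: finset.setSI.
apply: le_trans (IH (recoord b a) D' ubs upD').
rewrite le_measure ?inE; [by []|exact: (@measurable_exceed _ _ n _ q (fits _ a D))
  |exact: (@measurable_exceed _ _ n _ q (fits _ (recoord b a) D'))|].
(* A section chosen over [b :: bs] also serves over [bs], and [t b] is the point chosen over [b]. *)
move=> x [t pt Dt]; exists t => //; exists (t b) => //; apply: upD Dt.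
apply/fintype.subsetP => i; rewrite !inE /recoord.
case: (eqVneq (pi (a i)) b) => [e|ne] /=; first by rewrite s_section e (negPf bbs) => /andP[-> ->].
by move=> /andP[-> ->].
Qed.

End switching.

(** * Use of (B): comparison of the two measures on increasing threshold events *)

Section core.
Variables (R : realType) (A B : countType) (pi : A -> B).
Variables (mu rho : probability (prodE R A) R) (s : B -> A).
Hypothesis mu_nonneg : mu [set x : prodE R A | forall a, (0 <= x a)%E] = 1%E.
Hypothesis mu_lift : is_lift pi mu.
Hypothesis s_section : forall b, pi (s b) = b.
Hypothesis condA : forall (b : B) (a : A), pi a = b ->
     forall H : set (prodE R A),
       <<s coord_sets R A (fun c : A => pi c <> b) >> H ->
       (0 < rho H)%E ->
       stoch_dom (fun x y : \bar R => (x <= y)%E)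
         (cond_coord rho H (s b)) (cond_coord rho H a).
Hypothesis condB : stoch_dom (@prod_le R A)
     (fun U => mu (lift_collapse pi s @^-1` U)) rho.

Lemma measurable_lift_collapse : measurable_fun setT (@lift_collapse R A B pi s).
Proof.
apply: (@measurability _ _ (prodE R A) (prodE R A) setT (@lift_collapse R A B pi s) (coord_sets R A (fun=> True))) => //.
move=> _ [_ [a [U [_ [mU ->]]]] <-].
have : measurable_fun setT (fun y : prodE R A => lift_collapse pi s y a); last first.
  by move=> /(_ measurableT _ mU).
rewrite /lift_collapse; case: (s (pi a) == a); last exact: measurable_cst.
apply: (measurability _ (ErealGenOInfty.measurableE R)) => //.
move=> _ [_ [r ->] <-].
rewrite (_ : _ `&` _ = \bigcup_(c in pi @^-1` [set pi a]) [set y : prodE R A | (r%:E < y c)%E]).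
  apply: bigcup_countable_measurable => c.
  by rewrite -[[set _ | _]]setTI; apply: emeasurable_fun_o_infty => //; exact: measurable_coord.
apply/seteqP; split=> y /=.
  by move=> [_]; rewrite in_itv/= andbT => /ereal_sup_gt[_ [c cb <-] ry]; exists c.
move=> [c cb ry]; split=> //; rewrite in_itv/= andbT.
by apply: (lt_le_trans ry); apply: ereal_sup_ubound; exists c.
Qed.

Lemma exceed_up_le n (a : 'I_n -> A) (q : 'I_n -> R) (D : {set 'I_n} -> Prop) :
  (forall i, 0 < q i) -> (forall u v : {set 'I_n}, u \subset v -> D u -> D v) ->
  (mu [set x | D (exceed a q x)] <= rho [set x | D (exceed a q x)])%E.
Proof.
(* Only the finitely many fibres met by the conditions need switching. *)
move=> q0 upD; pose bs := undup (codom (fun i => pi (a i))).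
have bsP i : pi (a i) \in bs by rewrite mem_undup codom_f.
apply: le_trans (@switch_fibers _ _ _ _ _ _ s_section condA bs n a q D (undup_uniq _) upD).
(* This is the event [E*] of the overview; it is increasing, as (B) requires. *)
set E := [set x | fits _ _ _ _ _].
have mE : measurable E by exact: (@measurable_exceed _ _ n _ q (fits pi bs a D)).
have upE x y : prod_le x y -> E x -> E y.
  move=> xy [t pt Dt]; exists t => //; apply: upD Dt; apply: finset.setSI.
  by apply/fintype.subsetP => i; rewrite !inE => /le_trans; apply; exact: xy.
apply: le_trans (stoch_dom_le condB mE upE).
have [N [mN muN0 NP]] := mu_lift.
pose pos := [set x : prodE R A | forall a, (0 <= x a)%E].
have mpos : measurable pos by exact: measurable_nonneg.
have mcE : measurable (lift_collapse pi s @^-1` E).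
  by rewrite -[_ @^-1` _]setTI; exact: measurable_lift_collapse.
apply: (@le_trans _ _ (mu (lift_collapse pi s @^-1` E `|` (N `|` ~` pos)))); last first.
  apply: (le_trans (measureU2 _ _ _)) => //; first by apply: measurableU => //; exact: measurableC.
  apply: (@le_trans _ _ (mu (lift_collapse pi s @^-1` E) + (mu N + mu (~` pos)))%E).
    by rewrite leeD2l//; apply: measureU2 => //; exact: measurableC.
  by rewrite [X in (_ + (X + _))%E](_ : _ = 0%E)// probability_setC// mu_nonneg subee// !adde0.
rewrite le_measure ?inE; [by []|exact: measurable_exceed| |].
  by apply: measurableU => //; apply: measurableU => //; exact: measurableC.
move=> y Dy; have [Ny|nNy] := pselect (N y); first by right; left.
have [y0|npos] := pselect (pos y); last by right; right.
left.
have uniq_nz : forall b a1 a2, pi a1 = b -> pi a2 = b ->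
    y a1 <> 0%E -> y a2 <> 0%E -> a1 = a2.
  by move: nNy; apply: contra_notP; exact: NP.
(* [t] picks in each fibre the only coordinate that may be nonzero, or [s b] if there is none. *)
have [t tP] : exists t : B -> A, forall b, pi (t b) = b /\
    forall c, pi c = b -> y c <> 0%E -> c = t b.
  have tE b : exists c0, pi c0 = b /\ forall c, pi c = b -> y c <> 0%E -> c = c0.
    have [[c [cb yc]]|no] := pselect (exists c, pi c = b /\ y c <> 0%E).
      by exists c; split=> // c' c'b yc'; exact: uniq_nz c'b cb yc' yc.
    by exists (s b); split=> // c cb yc; case: no; exists c.
  by have [t tP] := choice tE; exists t.
exists t; first by move=> b; case: (tP b).
apply: upD Dy; apply/fintype.subsetP => i; rewrite !inE bsP /= => qy.
(* A met condition has a positive threshold, so it sits at a point of [t], and the supremum over the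
   fibre meets it too. *)
have yn : y (a i) <> 0%E by move=> e; move: qy; rewrite e lee_fin leNgt q0.
have [_ /(_ (a i) erefl yn) <-] := tP (pi (a i)); rewrite eqxx andbT.
rewrite /lift_collapse s_section eqxx; apply: (le_trans qy).
by apply: ereal_sup_ubound; exists (a i).
Qed.
End core.

(** * Realization of finitely additive probabilities on the Cantor space *)

Definition cylinders : set (set (nat -> bool)) :=
  [set S | exists k (Q : set (seq bool)), S = [set z | Q (mkseq z k)]].

Definition cantor := g_sigma_algebraType cylinders.

Section unit_interval.
Variable R : realType.

(** The interval is half-open so that the half-open intervals attached to the words of a given
    length tile it. *)
Definition unit_measure : set (measurableTypeR R) -> \bar R :=
  mrestr lebesgue_measure (measurable_itv `[0%R, 1%R[).

HB.instance Definition _ := Measure.on unit_measure.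

Lemma unit_measure_setT : unit_measure setT = 1%E.
Proof.
by rewrite /unit_measure /mrestr setTI lebesgue_measure_itv/= lte_fin ltr01 sube0.
Qed.

HB.instance Definition _ :=
  @Measure_isProbability.Build _ _ R unit_measure unit_measure_setT.
End unit_interval.

Lemma mkseqSr (T : Type) (f : nat -> T) k : mkseq f k.+1 = rcons (mkseq f k) (f k).
Proof. by rewrite /mkseq -addn1 iotaD map_cat /= cats1. Qed.

Definition prefix_tuple k (z : nat -> bool) : k.-tuple bool :=
  Tuple (introT eqP (size_mkseq z k)).

Section nested_intervals.
Variables (R : realType) (m : seq bool -> R).
Hypothesis m_ge0 : forall u, 0 <= m u.
Hypothesis m_nil : m [::] = 1.
Hypothesis m_split : forall u, m u = m (rcons u false) + m (rcons u true).

(** This is the total mass of the words of the same length that precede [u] lexicographically; the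
    word [u] owns the interval of length [m u] starting there. *)
Definition left_end (u : seq bool) : R :=
  \sum_(i < size u) (if nth false u i then m (rcons (take i u) false) else 0).

Lemma left_end_rcons u b :
  left_end (rcons u b) = left_end u + (if b then m (rcons u false) else 0).
Proof.
rewrite /left_end size_rcons big_ord_recr /= nth_rcons ltnn eqxx.
rewrite -cats1 take_cat ltnn subnn take0 cats0; congr (_ + _).
by apply: eq_bigr => i _; rewrite nth_cat take_cat ltn_ord.
Qed.

Fixpoint nested_prefix (x : R) k : seq bool :=
  if k is k'.+1 then
    let u := nested_prefix x k' in rcons u (left_end u + m (rcons u false) <= x)
  else [::].

Definition nested_bits (x : measurableTypeR R) : cantor :=
  fun k => let u := nested_prefix x k in left_end u + m (rcons u false) <= x.

Lemma mkseq_nested_bits x k : mkseq (nested_bits x) k = nested_prefix x k.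
Proof. by elim: k => // k IH; rewrite mkseqSr IH. Qed.

(** The interval of [u] is cut at [left_end u + m (rcons u false)] into those of its two extensions,
    and the next bit of [x] tells the side. *)
Lemma nested_prefixP x u : 0 <= x < 1 ->
  (nested_prefix x (size u) == u) = (left_end u <= x < left_end u + m u).
Proof.
move=> x01; elim/last_ind: u => [|u b IH] /=.
  by rewrite /left_end big_ord0 m_nil add0r x01.
rewrite size_rcons /= eqseq_rcons.
have mf := m_ge0 (rcons u false); have mt := m_ge0 (rcons u true).
case: (eqVneq (nested_prefix x (size u)) u) IH => [->|_] /esym IH;
  move: IH; rewrite left_end_rcons (m_split u) /=.
  move=> /andP[h1 h2].
  case: b; first by rewrite eqb_id; apply/idP/andP => [h|[]//]; split=> //; lra.
  by rewrite eqbF_neg -ltNge addr0; apply/idP/andP => [h|[]//]; split.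
(* If an earlier bit differs, [x] is outside the interval of [u], hence outside that of its
   extension. *)
move=> /negbT/negP no; apply/esym/negP => /andP[h1 h2]; apply: no.
by apply/andP; case: b h1 h2 => h1 h2; split; lra.
Qed.

Lemma measurable_nested_prefix u :
  measurable [set x : measurableTypeR R | nested_prefix x (size u) = u].
Proof.
elim/last_ind: u => [|u b mu].
  by rewrite (_ : [set _ | _] = setT)//; apply/seteqP; split.
rewrite (_ : [set _ | _] = [set x : measurableTypeR R | nested_prefix x (size u) = u] `&`
  (if b then `[left_end u + m (rcons u false), +oo[%classic
   else `]-oo, left_end u + m (rcons u false)[%classic)).
  by apply: measurableI => //; case: b.
apply/seteqP; split => x /=; rewrite size_rcons /=.
  move=> /rcons_inj[-> <-]; split=> //.
  by case: leP => h; rewrite /= in_itv/= ?andbT.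
move=> [-> ]; case: b => /=; rewrite in_itv/= ?andbT => h; first by rewrite h.
by rewrite leNgt h.
Qed.

Lemma measurable_nested_bits : measurable_fun setT nested_bits.
Proof.
apply: (@measurability _ _ (measurableTypeR R) cantor setT nested_bits cylinders) => //.
move=> _ [_ [k [Q ->]] <-]; rewrite setTI.
rewrite (_ : _ @^-1` _ = \bigcup_(w in [set w : k.-tuple bool | Q w])
    [set x : measurableTypeR R | nested_prefix x (size w) = w]).
  by apply: fin_bigcup_measurable => // w _; exact: measurable_nested_prefix.
apply/seteqP; split=> x /=; rewrite mkseq_nested_bits.
  have sz : size (nested_prefix x k) == k by rewrite -mkseq_nested_bits size_mkseq.
  by move=> Qx; exists (Tuple sz) => //=; rewrite (eqP sz).
by move=> [w /= Qw]; rewrite size_tuple => ->.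
Qed.

Lemma unit_measure_nested_bits u :
  unit_measure (nested_bits @^-1` [set z | mkseq z (size u) = u]) = (m u)%:E.
Proof.
rewrite /unit_measure /mrestr (_ : _ `&` _ = `[left_end u, left_end u + m u[%classic).
  rewrite lebesgue_measure_itv/= lte_fin ltrDl; case: ifPn => [_|].
    by rewrite -EFinD addrAC subrr add0r.
  by rewrite -leNgt => mu0; congr EFin; apply/eqP; rewrite eq_le m_ge0.
(* The interval of [u] stays in the unit interval, so the restriction cuts nothing off. *)
have bound : 0 <= left_end u /\ left_end u + m u <= 1.
  elim/last_ind: u => [|u b]; first by rewrite /left_end big_ord0 m_nil; lra.
  rewrite left_end_rcons (m_split u).
  have := m_ge0 (rcons u false); have := m_ge0 (rcons u true).
  by case: b; lra.
apply/seteqP; split=> x /=; rewrite mkseq_nested_bits !in_itv/=.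
  by move=> [/eqP + x01]; rewrite nested_prefixP.
move=> xu; have x01 : 0 <= x < 1 by lra.
by split=> //; apply/eqP; rewrite nested_prefixP.
Qed.
End nested_intervals.

Section finitely_additive.
Variables (R : realType) (M : set (nat -> bool) -> R).
Hypothesis M_ge0 : forall S, 0 <= M S.
Hypothesis M_setT : M setT = 1.
Hypothesis MU : forall S S', S `&` S' = set0 -> M (S `|` S') = M S + M S'.

Lemma finitely_additive0 : M set0 = 0.
Proof. by apply: (@addrI _ (M set0)); rewrite -MU ?setU0 ?setI0// addr0. Qed.

Lemma finitely_additive_fibers (I : finType) (f : (nat -> bool) -> I) S :
  M S = \sum_(w : I) M (S `&` f @^-1` [set w]).
Proof.
rewrite -[LHS](_ : M (S `&` [set z | f z \in index_enum I]) = _); last first.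
  by congr M; apply/seteqP; split=> z //= => [[]//|]; rewrite mem_index_enum.
elim: (index_enum I) (index_enum_uniq I) => [_|w r IH /= /andP[wr ur]].
  rewrite big_nil -[RHS]finitely_additive0; congr M.
  by apply/seteqP; split=> z // [_ /=].
rewrite big_cons -IH// -MU; last first.
  by apply/seteqP; split=> z //= [[_ ->] [_]]; rewrite (negPf wr).
congr M; apply/seteqP; split=> z /=; rewrite inE.
  by move=> [Sz /predU1P[]]; [left|right].
by move=> [[Sz ->]|[Sz ->]]; rewrite ?eqxx ?orbT.
Qed.

(** Finite additivity is enough on cylinders: the masses of words are consistent under extension by
    one bit, and a cylinder is a finite disjoint union of prefix events. *)
Lemma finitely_additive_realization :
  exists beta : measurableTypeR R -> cantor, measurable_fun setT beta /\
    forall S, cylinders S -> unit_measure (beta @^-1` S) = (M S)%:E.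
Proof.
pose m u := M [set z | mkseq z (size u) = u].
have m_nil : m [::] = 1 by rewrite -M_setT; congr M; apply/seteqP; split.
have m_split u : m u = m (rcons u false) + m (rcons u true).
  rewrite /m -MU.
    congr M; apply/seteqP; split=> z /=; rewrite !size_rcons mkseqSr.
      by move=> ->; case: (z _); [right|left].
    by move=> [|] /rcons_inj[].
  apply/seteqP; split=> z //=; rewrite !size_rcons mkseqSr.
  by move=> [/rcons_inj[_ ->] /rcons_inj[]].
have m_ge0 u : 0 <= m u by exact: M_ge0.
have mb := measurable_nested_bits m.
exists (nested_bits m); split=> // _ [k [Q ->]].
rewrite (@measure_fibers _ _ _ (@unit_measure R) _
  (fun x => prefix_tuple k (nested_bits m x))); last first.
  move=> w; rewrite (_ : _ `&` _ = nested_bits m @^-1`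
    [set z | Q (mkseq z k) /\ mkseq z k = w]).
    rewrite -[_ @^-1` _]setTI; apply: mb => //.
    by apply: sub_sigma_algebra; exists k, (fun u => Q u /\ u = w).
  by apply/seteqP; split=> x /= [Qx]; [move=> <-|move=> e; split=> //; exact/val_inj].
rewrite (finitely_additive_fibers (@prefix_tuple k)) -sumEFin.
apply: eq_bigr => w _.
have [Qw|nQw] := pselect (Q w).
  rewrite [X in _ = (M X)%:E](_ : _ = [set z | mkseq z (size w) = w]).
    rewrite -[RHS](unit_measure_nested_bits m_ge0 m_nil m_split w); congr unit_measure.
    apply/seteqP; split=> x /=; rewrite size_tuple; first by move=> [_ <-].
    by move=> e; rewrite e; split=> //; exact/val_inj.
  apply/seteqP; split=> x /=; rewrite size_tuple; first by move=> [_ <-].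
  by move=> e; rewrite e; split=> //; exact/val_inj.
rewrite [X in _ = (M X)%:E](_ : _ = set0); last first.
  by apply/seteqP; split=> z //= [Qz zw]; apply: nQw; rewrite -zw.
rewrite finitely_additive0 (_ : _ `&` _ = set0) ?measure0//.
by apply/seteqP; split=> z //= [Qz zw]; apply: nQw; rewrite -zw.
Qed.
End finitely_additive.

(** * Monotone coupling of bit sequences *)

(** Compactness of the segment gives a cluster point, and a cluster point of an ultrafilter is a
    limit. *)
Lemma ultra_cvg_bounded (R : realType) (T : Type) (F : set_system T) (f : T -> R) :
  UltraFilter F -> (forall x, 0 <= f x <= 1) ->
  exists2 l : R, 0 <= l <= 1 & f x @[x --> F] --> l.
Proof.
move=> UF f01; have FF : ProperFilter F by exact: ultra_proper.
have [|l [/= l01 cl]] := @segment_compact R 0 1 (f @ F) _.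
  by rewrite /nbhs /=; apply: filterE => x /=; rewrite in_itv/= f01.
exists l; first by rewrite in_itv/= in l01.
move=> V Vl; have [//|nV] := in_ultra_setVsetC (f @^-1` V) UF.
by have [y [nVy Vy]] := cl (~` V) V nV Vl.
Qed.

Definition finitely_additive_proba (R : realType) (T : Type) (M : set T -> R) :=
  [/\ forall S, 0 <= M S, M setT = 1 &
      forall S S', S `&` S' = set0 -> M (S `|` S') = M S + M S'].

(** Along an ultrafilter finer than [\oo], all sets have a limit at once; limits respect finite sums
    and keep eventually constant values. *)
Lemma finitely_additive_limit (R : realType) (T : Type) (Mn : nat -> set T -> R) :
  (forall n, finitely_additive_proba (Mn n)) ->
  exists M, finitely_additive_proba M /\
    forall S c n0, (forall n, (n0 <= n)%N -> Mn n S = c) -> M S = c.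
Proof.
move=> fa.
have [U [UU sU]] := @ultraFilterLemma nat \oo _.
have UF : ProperFilter U by exact: ultra_proper.
have Mn01 S n : 0 <= Mn n S <= 1.
  have [ge0 tot add] := fa n; rewrite ge0 -tot -(setUv S) add ?setICr//.
  by rewrite lerDl ge0.
have lim S : exists l : R, (0 <= l <= 1) /\ Mn n S @[n --> U] --> l.
  by have [l l01 cl] := ultra_cvg_bounded UU (Mn01 S); exists l.
have [M MP] := choice lim.
have Meq S c n0 : (forall n, (n0 <= n)%N -> Mn n S = c) -> M S = c.
  move=> eqc; have [_ cl] := MP S.
  have cc : Mn n S @[n --> U] --> c.
    by apply: cvg_near_cst; apply: sU; exists n0 => // n; exact: eqc.
  exact: (cvg_unique (@Rhausdorff R) cl cc).
exists M; split; last exact: Meq.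
split=> [S||S S' SS'].
- by have [/andP[]] := MP S.
- by apply: (@Meq _ _ 0%N) => n _; have [] := fa n.
- have [_ c1] := MP S; have [_ c2] := MP S'; have [_ c3] := MP (S `|` S').
  have c4 : Mn n (S `|` S') @[n --> U] --> M S + M S'.
    rewrite (_ : (fun n => Mn n (S `|` S')) = (fun n => Mn n S + Mn n S')).
      exact: cvgD.
    by apply/funext => n; have [_ _ ->] := fa n.
  exact: (cvg_unique (@Rhausdorff R) c3 c4).
Qed.

Section bit_coupling.
Variables (R : realType) (d : measure_display) (T : measurableType d).
Variables (mu rho : probability T R) (e : nat -> T -> bool).
Hypothesis me : forall k, measurable [set x | e k x].

Definition first_bits n (x : T) : {set 'I_n} := finset (fun i : 'I_n => e i x).

Lemma measurable_first_bits n (Q : {set 'I_n} -> Prop) :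
  measurable [set x | Q (first_bits n x)].
Proof. exact: measurable_finset. Qed.

(** The finite pattern becomes an infinite sequence, with [false] from [n] on. *)
Definition bit n (u : {set 'I_n}) (k : nat) : bool := [exists i in u, i == k :> nat].

Lemma bit_first_bits n x k : (k < n)%N -> bit (first_bits n x) k = e k x.
Proof.
move=> kn; apply/existsP/idP => [[i /andP[+ /eqP <-]]|ek]; first by rewrite inE.
by exists (Ordinal kn); rewrite inE ek eqxx.
Qed.

Lemma measurable_mkseq k (Q : seq bool -> Prop) :
  measurable [set x | Q (mkseq (e^~ x) k)].
Proof.
rewrite (_ : [set _ | _] = [set x | Q (mkseq (bit (first_bits k x)) k)]).
  exact: (measurable_first_bits (fun u => Q (mkseq (bit u) k))).
apply/funext => x /=; congr Q; apply/eq_in_map => i.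
by rewrite mem_iota add0n => /andP[_ ik]; rewrite bit_first_bits.
Qed.

Definition weight (nu : probability T R) n (u : {set 'I_n}) : R :=
  fine (nu [set x | first_bits n x = u]).

Lemma weight_ge0 nu n (u : {set 'I_n}) : 0 <= weight nu u.
Proof. exact: fine_ge0. Qed.

Lemma sum_weight nu n (C : {set {set 'I_n}}) :
  (\sum_(u in C) weight nu u)%:E = nu [set x | first_bits n x \in C].
Proof.
rewrite (@measure_fibers _ _ _ nu _ (first_bits n)); last first.
  move=> w; apply: measurableI; first exact: (measurable_first_bits (fun u => u \in C)).
  exact: (measurable_first_bits (fun u => u = w)).
rewrite -sumEFin [RHS](bigID (mem C)) /= [X in (_ + X)%E]big1 ?adde0.
  apply: eq_bigr => u uC; rewrite /weight fineK.
    congr (nu _); apply/seteqP; split=> x /=; last by case.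
    by move=> fx; rewrite fx.
  by apply: fin_num_measure; exact: (measurable_first_bits (fun v => v = u)).
move=> u uC; rewrite (_ : _ `&` _ = set0) ?measure0//.
by apply/seteqP; split=> x //= [+ fx]; rewrite fx (negPf uC).
Qed.

Lemma sum_weight_mkseq nu n k (Q : set (seq bool)) : (k <= n)%N ->
  \sum_(u : {set 'I_n}) weight nu u * (mkseq (bit u) k \in Q)%:R =
  fine (nu [set x | Q (mkseq (e^~ x) k)]).
Proof.
move=> kn; pose C : {set {set 'I_n}} := finset (fun u => mkseq (bit u) k \in Q).
transitivity (\sum_(u in C) weight nu u).
  rewrite [RHS]big_mkcond; apply: eq_bigr => u _; rewrite inE.
  by case: (_ \in Q); rewrite ?mulr1 ?mulr0.
apply: EFin_inj; rewrite sum_weight fineK; last first.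
  by apply: fin_num_measure; exact: measurable_mkseq.
congr (nu _); apply/funext => x /=; rewrite inE.
rewrite (_ : mkseq (bit (first_bits n x)) k = mkseq (e^~ x) k).
  by apply/propext; split; rewrite ?inE//; move/set_mem.
apply/eq_in_map => i.
by rewrite mem_iota add0n => /andP[_ ik]; rewrite bit_first_bits// (leq_trans ik kn).
Qed.

Hypothesis up_le : forall n (D : {set 'I_n} -> Prop),
  (forall u v : {set 'I_n}, u \subset v -> D u -> D v) ->
  (mu [set x | D (first_bits n x)] <= rho [set x | D (first_bits n x)])%E.

(** For inclusion, [nbhd C] is the up-closure of [C], so [up_le] yields Hall's condition. Both
    totals are 1, which turns the bound on the second marginal into an equality. *)
Lemma first_bits_coupling n : exists w : {set 'I_n} -> {set 'I_n} -> R,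
  [/\ forall u v, 0 <= w u v, forall u v : {set 'I_n}, ~~ (u \subset v) -> w u v = 0,
      forall u, \sum_v w u v = weight mu u &
      forall v, \sum_u w u v = weight rho v].
Proof.
have [||C|w [w0 wr wp wq]] := @hall_coupling R _ _
  (fun u v : {set 'I_n} => u \subset v) (@weight mu n) (@weight rho n).
- exact: weight_ge0.
- exact: weight_ge0.
- rewrite -lee_fin !sum_weight.
  apply: (@le_trans _ _ (mu [set x | first_bits n x \in nbhd (fun u v : {set 'I_n} => u \subset v) C])).
    rewrite le_measure ?inE//.
    + exact: (measurable_first_bits (fun u => u \in C)).
    + exact: (measurable_first_bits (fun u => u \in nbhd _ C)).
    + move=> x /= xC; rewrite inE; apply/existsP; exists (first_bits n x).
      by rewrite xC subxx.
  apply: (@up_le n (fun t => t \in nbhd _ C)) => u v uv; rewrite !inE => /existsP[t /andP[tC tu]].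
  by apply/existsP; exists t; rewrite tC (fintype.subset_trans tu uv).
exists w; split=> // v.
have tot nu : \sum_(u : {set 'I_n}) weight nu u = 1.
  apply: EFin_inj; rewrite -(@probability_setT _ _ _ nu).
  rewrite (_ : \sum_u _ = \sum_(u in [set: {set 'I_n}]%SET) weight nu u).
    by rewrite sum_weight; congr (nu _); apply/seteqP; split=> x //= _; rewrite inE.
  by apply: eq_bigl => u; rewrite inE.
have : \sum_v (weight rho v - \sum_u w u v) = 0.
  by rewrite sumrB tot exchange_big /= (eq_bigr _ (fun u _ => wp u)) tot subrr.
move/eqP; rewrite psumr_eq0 => [/allP /(_ v)|v' _]; last by rewrite subr_ge0.
by rewrite mem_index_enum => /(_ isT) /=; rewrite subr_eq0 => /eqP.
Qed.

(** A pair of sequences is stored as one, so that a single map [beta] can realize a coupling. *)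
Definition interleave (x y : nat -> bool) : nat -> bool :=
  fun k => if odd k then y k./2 else x k./2.

Definition evens (z : cantor) : cantor := fun k => z k.*2.
Definition odds (z : cantor) : cantor := fun k => z k.*2.+1.

Lemma evens_interleave x y : evens (interleave x y) = x.
Proof. by apply/funext => k; rewrite /evens /interleave odd_double doubleK. Qed.

Lemma odds_interleave x y : odds (interleave x y) = y.
Proof. by apply/funext => k; rewrite /odds /interleave /= odd_double uphalf_double. Qed.

Lemma cylinders_evens S : cylinders S -> cylinders (evens @^-1` S).
Proof.
move=> [k [Q ->]]; exists k.*2.
exists (fun u => Q (mkseq (fun i => nth false u i.*2) k)).
apply/funext => z /=; congr Q; apply/eq_in_map => i.
by rewrite mem_iota add0n => /andP[_ ik]; rewrite nth_mkseq// ltn_double.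
Qed.

Lemma cylinders_odds S : cylinders S -> cylinders (odds @^-1` S).
Proof.
move=> [k [Q ->]]; exists k.*2.
exists (fun u => Q (mkseq (fun i => nth false u i.*2.+1) k)).
apply/funext => z /=; congr Q; apply/eq_in_map => i.
by rewrite mem_iota add0n => /andP[_ ik]; rewrite nth_mkseq// ltn_Sdouble.
Qed.

Lemma cylinders_violation k : cylinders [set z | evens z k && ~~ odds z k].
Proof.
exists k.*2.+2, (fun u => nth false u k.*2 && ~~ nth false u k.*2.+1).
by apply/funext => z; rewrite /mkset !nth_mkseq.
Qed.

Lemma bit_coupling : exists beta : measurableTypeR R -> cantor,
  [/\ measurable_fun setT beta,
   forall k (Q : set (seq bool)), unit_measure (beta @^-1` [set z | Q (mkseq (evens z) k)]) =
     mu [set x | Q (mkseq (e^~ x) k)],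
   forall k (Q : set (seq bool)), unit_measure (beta @^-1` [set z | Q (mkseq (odds z) k)]) =
     rho [set x | Q (mkseq (e^~ x) k)] &
   forall k, unit_measure (beta @^-1` [set z | evens z k && ~~ odds z k]) = 0%E].
Proof.
pose w n := sval (cid (first_bits_coupling n)).
have wP n : [/\ forall u v, 0 <= w n u v,
    forall u v : {set 'I_n}, ~~ (u \subset v) -> w n u v = 0,
    forall u, \sum_v w n u v = weight mu u &
    forall v, \sum_u w n u v = weight rho v] := svalP (cid (first_bits_coupling n)).
pose Mn n (S : set (nat -> bool)) : R := \sum_(u : {set 'I_n}) \sum_(v : {set 'I_n})
  w n u v * (interleave (bit u) (bit v) \in S)%:R.
(* From [n = k] on, the value does not depend on [n], so the limit inherits it. *)
have Mn_evens n k Q : (k <= n)%N -> Mn n [set z | Q (mkseq (evens z) k)] =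
    fine (mu [set x | Q (mkseq (e^~ x) k)]).
  move=> kn; rewrite -(@sum_weight_mkseq mu _ _ _ kn); apply: eq_bigr => u _.
  have [_ _ <- _] := wP n; rewrite mulr_suml; apply: eq_bigr => v _.
  congr (_ * _%:R); congr nat_of_bool.
  by apply/idP/idP => /set_mem /= h; apply/mem_set; move: h; rewrite /= evens_interleave.
have Mn_odds n k Q : (k <= n)%N -> Mn n [set z | Q (mkseq (odds z) k)] =
    fine (rho [set x | Q (mkseq (e^~ x) k)]).
  move=> kn; rewrite -(@sum_weight_mkseq rho _ _ _ kn) /Mn exchange_big /=.
  apply: eq_bigr => v _.
  have [_ _ _ <-] := wP n; rewrite mulr_suml; apply: eq_bigr => u _.
  congr (_ * _%:R); congr nat_of_bool.
  by apply/idP/idP => /set_mem /= h; apply/mem_set; move: h; rewrite /= odds_interleave.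
have Mn_le n k : Mn n [set z | evens z k && ~~ odds z k] = 0.
  rewrite /Mn big1// => u _; rewrite big1// => v _.
  have [uv|nuv] := boolP (u \subset v); last first.
    by have [_ -> //] := wP n; rewrite mul0r.
  rewrite memNset ?mulr0//= evens_interleave odds_interleave => /andP[].
  move=> /existsP[i /andP[iu ik]] /negP; apply; apply/existsP; exists i.
  by rewrite ik (fintype.subsetP uv).
have faMn n : finitely_additive_proba (Mn n).
  split=> [S||S S' SS'].
  - by do 2 apply: sumr_ge0 => ? _; rewrite mulr_ge0//; have [] := wP n.
  - have := Mn_evens n 0 setT (leq0n n); rewrite probability_setT /=.
    by move=> <-; congr (Mn n _).
  - rewrite -big_split; apply: eq_bigr => u _; rewrite -big_split.
    apply: eq_bigr => v _; rewrite /= -mulrDr -natrD in_setU; congr (_ * _%:R).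
    set z := interleave _ _.
    have := in_set0 z; rewrite -SS' in_setI.
    by case: (z \in S); case: (z \in S').
have [M [[M0 M1 MU] Mlim]] := finitely_additive_limit faMn.
have [beta [mbeta betaP]] := finitely_additive_realization M0 M1 MU.
exists beta; split=> // [k Q|k Q|k].
- rewrite betaP; last by apply: (@cylinders_evens [set z | Q (mkseq z k)]); exists k, Q.
  rewrite (@Mlim _ (fine (mu [set x | Q (mkseq (e^~ x) k)])) k) => [|n kn].
    by rewrite fineK// fin_num_measure//; exact: measurable_mkseq.
  exact: Mn_evens.
- rewrite betaP; last by apply: (@cylinders_odds [set z | Q (mkseq z k)]); exists k, Q.
  rewrite (@Mlim _ (fine (rho [set x | Q (mkseq (e^~ x) k)])) k) => [|n kn].
    by rewrite fineK// fin_num_measure//; exact: measurable_mkseq.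
  exact: Mn_odds.
- rewrite betaP; last exact: cylinders_violation.
  by rewrite (@Mlim _ 0 0%N)// => n _; exact: Mn_le.
Qed.
End bit_coupling.

(** * Decoding *)

Lemma measurable_evens : measurable_fun setT evens.
Proof.
apply: (@measurability _ _ cantor cantor setT evens cylinders) => //.
move=> _ [S cS <-]; rewrite setTI; apply: sub_sigma_algebra; exact: cylinders_evens.
Qed.

Lemma measurable_odds : measurable_fun setT odds.
Proof.
apply: (@measurability _ _ cantor cantor setT odds cylinders) => //.
move=> _ [S cS <-]; rewrite setTI; apply: sub_sigma_algebra; exact: cylinders_odds.
Qed.

(** Cylinders are closed under intersection, by passing to the longer prefix, and generate the
    sigma-algebra. *)
Lemma cylinders_law_unique (R : realType) d1 d2 (T1 : measurableType d1)
    (T2 : measurableType d2) (P1 : probability T1 R) (P2 : probability T2 R)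
    (f1 : T1 -> cantor) (f2 : T2 -> cantor) :
  measurable_fun setT f1 -> measurable_fun setT f2 ->
  (forall k (Q : set (seq bool)), P1 (f1 @^-1` [set z | Q (mkseq z k)]) =
                                  P2 (f2 @^-1` [set z | Q (mkseq z k)])) ->
  forall S : set cantor, measurable S -> P1 (f1 @^-1` S) = P2 (f2 @^-1` S).
Proof.
move=> mf1 mf2 eqP S mS.
apply: (@measure_unique _ R cantor cylinders (fun=> setT) erefl _ _ _
  (measure_function_pushforward__canonical__measure_function_Measure P1 mf1)
  (measure_function_pushforward__canonical__measure_function_Measure P2 mf2)) => //.
- move=> _ _ [k [Q ->]] [k' [Q' ->]]; exists (maxn k k').
  exists (fun u => Q (take k u) /\ Q' (take k' u)); apply/funext => z /=.
  by rewrite /mkseq -!map_take !take_iota !(minn_idPl _) ?leq_maxl ?leq_maxr.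
- by move=> _; exists 0%N, setT; apply/seteqP; split.
- by rewrite bigcup_const.
- by move=> _ [k [Q ->]]; exact: eqP.
- by move=> k /=; rewrite /pushforward preimage_setT (le_lt_trans (probability_le1 _ _)) ?ltry.
Qed.

Section decoding.
Variables (R : realType) (A : countType) (a_ : nat -> A) (q_ : nat -> R).
Hypothesis q_gt0 : forall k, 0 < q_ k.
Hypothesis q_dense : forall a r, 0 < ratr r :> R -> exists2 k, a_ k = a & q_ k = ratr r.

Definition threshold k (x : prodE R A) : bool := ((q_ k)%:E <= x (a_ k))%E.

(** A coordinate in $[0,\infty]$ is the supremum of the positive rationals below it; the default 0
    is neutral there and gives the value 0 when no threshold is passed. *)
Definition decode (z : cantor) : prodE R A := fun a =>
  ereal_sup [set (if z k && (a_ k == a) then (q_ k)%:E else 0%E) | k in [set: nat]].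

Lemma decode_threshold (x : prodE R A) :
  (forall a, (0 <= x a)%E) -> decode (threshold^~ x) = x.
Proof.
move=> x0; apply/funext => a; apply/eqP; rewrite eq_le; apply/andP; split.
  apply: ge_ereal_sup => _ [k _ <-].
  by case: ifPn => // /andP[+ /eqP <-].
rewrite leNgt; apply/negP => lt_x.
have s0 : (0 <= decode (threshold^~ x) a)%E.
  apply: (@le_trans _ _ (if threshold 0 x && (a_ 0 == a) then (q_ 0)%:E else 0%E)).
    by case: ifP => // _; rewrite lee_fin ltW.
  by apply: ereal_sup_ubound; exists 0%N.
have [r /andP[s_r r_x]] : exists r : rat, (decode (threshold^~ x) a < (ratr r)%:E < x a)%E.
  case: (decode _ a) s0 lt_x => [t||] //= _; last by rewrite ltNge leey.
  case: (x a) => [y||]//=.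
    rewrite lte_fin => /rat_in_itvoo[r]; rewrite in_itv/= => ry.
    by exists r; rewrite !lte_fin.
  (* When [x a] is infinite, any rational above [t] works. *)
  move=> _; have /rat_in_itvoo[r] : t < t + 1 by rewrite ltrDl.
  by rewrite in_itv/= => /andP[tr _]; exists r; rewrite lte_fin tr ltry.
have r0 : 0 < ratr r :> R by rewrite -lte_fin (le_lt_trans s0).
have [k ak qk] := q_dense a r0.
move: s_r; apply/negP; rewrite -leNgt; apply: ereal_sup_ubound; exists k => //=.
by rewrite /threshold ak qk eqxx (ltW r_x).
Qed.

Lemma decode_le (z z' : cantor) : (forall k, z k -> z' k) -> prod_le (decode z) (decode z').
Proof.
move=> zz' a; apply: ge_ereal_sup => _ [k _ <-].
apply: (@le_trans _ _ (if z' k && (a_ k == a) then (q_ k)%:E else 0%E)).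
  case: (boolP (z k)) => [/zz' -> //|_ /=].
  by case: ifP => // _; rewrite lee_fin ltW.
by apply: ereal_sup_ubound; exists k.
Qed.

Lemma measurable_decode : measurable_fun setT decode.
Proof.
apply: (@measurability _ _ cantor (prodE R A) setT decode (coord_sets R A (fun=> True))) => //.
move=> _ [_ [a [U [_ [mU ->]]]] <-].
have : measurable_fun setT (fun z : cantor => decode z a); last first.
  by move=> /(_ measurableT _ mU).
apply: (measurability _ (ErealGenOInfty.measurableE R)) => //.
move=> _ [_ [r ->] <-].
rewrite (_ : _ `&` _ = \bigcup_k [set z : cantor |
    (r%:E < if z k && (a_ k == a) then (q_ k)%:E else 0)%E]).
  apply: bigcup_measurable => k _; apply: sub_sigma_algebra; exists k.+1.
  exists (fun u => (r%:E < if nth false u k && (a_ k == a) then (q_ k)%:E else 0)%E).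
  by apply/funext => z /=; rewrite nth_mkseq.
apply/seteqP; split=> y /=.
  by move=> [_]; rewrite in_itv/= andbT => /ereal_sup_gt[_ [k _ <-] ry]; exists k.
move=> [k _ ry]; split=> //; rewrite in_itv/= andbT.
by apply: (lt_le_trans ry); apply: ereal_sup_ubound; exists k.
Qed.

Lemma measurable_threshold k : measurable [set x | threshold k x].
Proof. exact: measurable_coord_ge. Qed.

Lemma measurable_code : measurable_fun setT (fun x : prodE R A => threshold^~ x : cantor).
Proof.
apply: (@measurability _ _ (prodE R A) cantor setT
  (fun x : prodE R A => threshold^~ x) cylinders) => //.
move=> _ [_ [k [Q ->]] <-]; rewrite setTI.
exact: (measurable_mkseq measurable_threshold).
Qed.

(** [f] has the law of the code of a [nu]-distributed point, and decoding that code returns the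
    point off a null set. *)
Lemma decode_law (nu : probability (prodE R A) R) d (Om : measurableType d)
    (P : probability Om R) (f : Om -> cantor) :
  nu [set x : prodE R A | forall a, (0 <= x a)%E] = 1%E ->
  measurable_fun setT f ->
  (forall k (Q : set (seq bool)), P (f @^-1` [set z | Q (mkseq z k)]) =
     nu [set x | Q (mkseq (threshold^~ x) k)]) ->
  forall U, measurable U -> P ((decode \o f) @^-1` U) = nu U.
Proof.
move=> nu_pos mf law U mU; rewrite comp_preimage.
have mdU : measurable (decode @^-1` U).
  by rewrite -[_ @^-1` _]setTI; exact: measurable_decode.
rewrite (cylinders_law_unique mf measurable_code law mdU).
set pos := [set x | _] in nu_pos.
have mpos : measurable pos by exact: measurable_nonneg.
have mcU : measurable ((fun x : prodE R A => threshold^~ x : cantor) @^-1` (decode @^-1` U)).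
  by rewrite -[_ @^-1` _]setTI; exact: measurable_code.
have restr V : measurable V -> nu V = nu (V `&` pos).
  move=> mV; rewrite (measureDI nu mV mpos).
  rewrite [X in (X + _)%E](_ : _ = 0%E) ?add0e//.
  apply/eqP; rewrite -measure_le0.
  rewrite (_ : 0%E = nu (~` pos)); last by rewrite probability_setC// nu_pos subee.
  by rewrite le_measure ?inE//; [exact: measurableD|exact: measurableC].
rewrite (restr _ mcU) (restr _ mU); congr (nu _).
apply/seteqP; split=> x [Ux xpos]; split=> //; move: Ux => /=.
  by rewrite decode_threshold.
by rewrite decode_threshold.
Qed.
End decoding.

Lemma threshold_stoch_dom (R : realType) (A : countType) (a0 : A)
    (mu rho : probability (prodE R A) R) :
  mu [set x : prodE R A | forall a, (0 <= x a)%E] = 1%E ->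
  rho [set x : prodE R A | forall a, (0 <= x a)%E] = 1%E ->
  (forall n (a : 'I_n -> A) (q : 'I_n -> R) (D : {set 'I_n} -> Prop),
    (forall i, 0 < q i) -> (forall u v : {set 'I_n}, u \subset v -> D u -> D v) ->
    (mu [set x | D (exceed a q x)] <= rho [set x | D (exceed a q x)])%E) ->
  stoch_dom (@prod_le R A) mu rho.
Proof.
move=> mu_pos rho_pos up_le.
(* Indices that code no pair with a positive rational default to [(a0, 1)], which keeps every
   threshold positive. *)
pose c k : A * rat :=
  if (unpickle k : option (A * rat)) is Some (a, r) then (if 0 < r then (a, r) else (a0, 1)) else (a0, 1).
pose a_ k := (c k).1; pose q_ k : R := ratr (c k).2.
have q_gt0 k : 0 < q_ k.
  by rewrite /q_ /c ltr0q; case: unpickle => [[a r]|]//=; case: ifP.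
have q_dense a r : 0 < ratr r :> R -> exists2 k, a_ k = a & q_ k = ratr r.
  rewrite ltr0q => r0.
  by exists (pickle (a, r)); rewrite /a_ /q_ /c pickleK r0.
have [beta [mbeta law_mu law_rho ae_le]] := @bit_coupling R _ (prodE R A) mu rho
  (threshold a_ q_) (measurable_threshold a_ q_)
  (fun n D => up_le n (fun i => a_ i) (fun i => q_ i) D (fun i => q_gt0 i)).
have mde : measurable_fun setT (evens \o beta) by exact: measurableT_comp measurable_evens mbeta.
have mdo : measurable_fun setT (odds \o beta) by exact: measurableT_comp measurable_odds mbeta.
exists _, (measurableTypeR R), (@unit_measure R),
  (decode a_ q_ \o (evens \o beta)), (decode a_ q_ \o (odds \o beta)); split.
- exact: measurableT_comp (measurable_decode a_ q_) mde.
- exact: measurableT_comp (measurable_decode a_ q_) mdo.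
- exact: decode_law.
- exact: decode_law.
(* Each bit is out of order on a null set only; off their countable union [decode_le] applies. *)
pose N k := beta @^-1` [set z | evens z k && ~~ odds z k].
have mN k : measurable (N k).
  rewrite -[N k]setTI; apply: mbeta => //; apply: sub_sigma_algebra.
  exact: cylinders_violation.
have : (@unit_measure R).-negligible (\bigcup_k N k).
  apply: negligible_bigcup => k; apply/negligibleP => //; exact: ae_le.
apply: negligibleS => w /=; apply: contra_notP => nN.
apply: decode_le => // k ek; apply/negPn/negP => ok; apply: nN; exists k => //.
by apply/andP.
Qed.

Unset Implicit Arguments. Set Strict Implicit. Set Printing Implicit Defensive.

Theorem theorem2p3 (R : realType) (A B : countType) (pi : A -> B)
  (neA : inhabited A) (neB : inhabited B)
  (pi_surj : forall b : B, exists a : A, pi a = b)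
  (mu rho : probability (prodE R A) R)
  (mu_nonneg : mu [set x : prodE R A | forall a, (0 <= x a)%E] = 1%E)
  (rho_nonneg : rho [set x : prodE R A | forall a, (0 <= x a)%E] = 1%E)
  (mu_lift : is_lift pi mu)
  (s : B -> A) (s_section : forall b, pi (s b) = b)
  (condA : forall (b : B) (a : A), pi a = b ->
     forall H : set (prodE R A),
       <<s coord_sets R A (fun c : A => pi c <> b) >> H ->
       (0 < rho H)%E ->
       stoch_dom (fun x y : \bar R => (x <= y)%E)
         (cond_coord rho H (s b)) (cond_coord rho H a))
  (condB : stoch_dom (@prod_le R A)
     (fun U => mu (lift_collapse pi s @^-1` U)) rho) :
  stoch_dom (@prod_le R A) mu rho.
Proof.
have [a0] := neA.
apply: (threshold_stoch_dom a0) => // n a q D q_gt0 upD.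
exact: (exceed_up_le mu_nonneg mu_lift s_section condA condB).
Qed.
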